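(* (Asymptotic-preserving property.) As $\varepsilon\to0$ (with $\Delta t$ fixed) one has $\tau\to1$, $\alpha\to0$, $\beta\to\frac1\lambda$, where $\tau=1-\exp(-\mu\Delta t/\varepsilon^2)$, $\alpha=\frac{\varepsilon^2}{\varepsilon^2+\lambda\Delta t}$, $\beta=\frac{\Delta t(1-\varepsilon^2)}{\varepsilon^2+\lambda\Delta t}$, so that the scheme $$r^*=(1-\tau)r^n+\tau(1-\tau)\frac{\mathcal P(r^n)}{\mu}+\tau^2\rho^nM,\qquad (j^*,\eta)=\alpha(j^n,\eta)-\beta v\,\mathcal L^+(r^*,\eta),\qquad \left(\frac{r^{n+1}-r^*}{\Delta t},\xi\right)+v\,\mathcal L^-(j^*,\xi)=0$$ becomes in the limit $$r^*=\rho^nM,\qquad (j^*,\eta)=-\frac v\lambda\,\mathcal L^+(r^*,\eta),\qquad \left(\frac{r^{n+1}-r^*}{\Delta t},\xi\right)+v\,\mathcal L^-(j^*,\xi)=0$$ for all $\eta,\xi\in\mathbb V_h^k$. If $(r^*,j^*,r^{n+1})$ satisfies this limiting scheme, then, with $g^*$ defined by $j^*=-\frac{vM}{\lambda}g^*$ and $\rho^{n+1}=\int_{\mathbb R}r^{n+1}\,dv$, one has $$(g^*,\eta)=\mathcal L^+(\rho^n,\eta),\qquad \left(\frac{\rho^{n+1}-\rho^n}{\Delta t},\xi\right)=D\,\mathcal L^-(g^*,\xi)\qquad\text{for all }\eta,\xi\in\mathbb V_h^k,$$ with $D=\int_{\mathbb R}\frac{v^2M}{\lambda}\,dv$; that is,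 the limiting scheme is the local discontinuous Galerkin scheme with forward Euler time stepping for the limiting diffusion equation $\partial_t\rho=D\,\partial_{xx}\rho$.
   Context: Space discretization. $\Omega_x=[x_L,x_R]$ is divided into $N_x$ uniform cells $I_i=[x_{i-\frac12},x_{i+\frac12}]$, $i=1,\dots,N_x$, of size $h=(x_R-x_L)/N_x$. $\mathbb V_h^k=\{u\in L^2(\Omega_x): u|_{I_i}\in\mathbb P^k(I_i)\ \forall i\}$, where $\mathbb P^k$ denotes polynomials of degree at most $k$. For $u\in\mathbb V_h^k$, $u^-_{i-\frac12}$ and $u^+_{i-\frac12}$ are the limits of $u$ at $x_{i-\frac12}$ from the left and from the right, and $[u]_{i-\frac12}=u^+_{i-\frac12}-u^-_{i-\frac12}$; with periodic boundary conditions the endpoints $x_L$ and $x_R$ are identified. $(u,w)=\int_{\Omega_x}uw\,dx$. For $\psi,u\in\mathbb V_h^k$, $$\mathcal L^{\pm}(\psi,u)=-(\psi,u_x)-\sum_{i=1}^{N_x}\psi^{\pm}_{i-\frac12}[u]_{i-\frac12},$$ where $u_x$ is the cellwise derivative. Velocity and collision operator. $v\in\mathbb R$, $M(v)=\frac{1}{\sqrt{2\pi}}e^{-v^2/2}$, $\sigma(v,w)=\sigma(w,v)>0$ is the scattering kernel, $\mathcal Q(f)(v)=\int_{\mathbb R}\sigma(v,w)\,(M(v)f(w)-M(w)f(v))\,dw$, $\lambda(v)=\int_{\mathbb R}\sigma(v,w)M(w)\,dw$ (the collision frequency), and $\mu>0$ is a constant with $\lambda\le\mu$. $\mathcal P(r)=\mathcal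 Q(r)+\mu r$ and $\rho^n=\int_{\mathbb R}r^n\,dv$. The unknowns $r^n,j^n,r^*,j^*,r^{n+1}$ are functions of $(x,v)$ which for each $v$ belong to $\mathbb V_h^k$ in $x$, and the equations of the scheme are required for every $v\in\mathbb R$. Here $0<\varepsilon<1$ and $E=0$. The functions $r$ and $j$ approximate the even and odd parities $\frac12(f(v)+f(-v))$ and $\frac1{2\varepsilon}(f(v)-f(-v))$ of the solution $f$ of $\varepsilon\partial_tf+v\partial_xf=\frac1\varepsilon\mathcal Q(f)$. The local discontinuous Galerkin (LDG) scheme with forward Euler for $\partial_t\rho=D\partial_{xx}\rho$ means the pair of displayed equations for $(g^*,\rho^{n+1})$, in which $g^*$ approximates $\partial_x\rho$ and alternating fluxes (right limit for $\rho$, left limit for $g$) are used. *)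

(* Defs.v *)
From HB Require Import structures.
From mathcomp Require Import all_boot all_order all_algebra.
From mathcomp Require Import all_classical all_reals all_analysis.
Set Implicit Arguments.
Unset Strict Implicit.
Unset Printing Implicit Defensive.
Import Order.TTheory GRing.Theory Num.Theory.
Import numFieldNormedType.Exports.
Local Open Scope classical_set_scope.
Local Open Scope ring_scope.

(* Cells and interfaces are indexed from 0: for i < N, [edge xL xR N i] is the
   left endpoint of the i-th cell and [edge xL xR N i.+1] its right endpoint. *)
Definition edge (R : realType) (xL xR : R) (N i : nat) : R :=
  xL + i%:R * ((xR - xL) / N%:R).

Definition cell (R : realType) (xL xR : R) (N i : nat) : set R :=
  `]edge xL xR N i, edge xL xR N i.+1[.

Definition cells (R : realType) (xL xR : R) (N : nat) : set R :=
  [set x | exists i : 'I_N, cell xL xR N i x].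

(* An element of V_h^k is a class in L^2; it is represented by a function which
   is a polynomial on every open cell. Its values at the finitely many
   interfaces and outside the domain are irrelevant, and none of the notions
   below depends on them. *)
Definition Vh (R : realType) (xL xR : R) (N k : nat) (u : R -> R) : Prop :=
  forall i : 'I_N, exists2 p : {poly R},
    (size p <= k.+1)%N & forall x, cell xL xR N i x -> u x = p.[x].

(* Functions of (x, v) which belong to V_h^k in x for every v. *)
Definition Vhv (R : realType) (xL xR : R) (N k : nat) (f : R -> R -> R) : Prop :=
  forall v, Vh xL xR N k (f ^~ v).

(* One-sided limits at the i-th interface. By periodicity the limit from the
   left at xL is the limit from the left at xR. *)
Definition trace_plus (R : realType) (xL xR : R) (N : nat) (u : R -> R)
    (i : 'I_N) : R :=
  lim (u x @[x --> (edge xL xR N i)^'+]).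

Definition trace_minus (R : realType) (xL xR : R) (N : nat) (u : R -> R)
    (i : 'I_N) : R :=
  lim (u x @[x --> (edge xL xR N (if i == 0 :> nat then N else i))^'-]).

Definition jump (R : realType) (xL xR : R) (N : nat) (u : R -> R)
    (i : 'I_N) : R :=
  trace_plus xL xR u i - trace_minus xL xR u i.

Definition inner (R : realType) (xL xR : R) (u w : R -> R) : R :=
  \int[lebesgue_measure]_(x in `[xL, xR]) (u x * w x).

Definition Lplus (R : realType) (xL xR : R) (N : nat) (psi u : R -> R) : R :=
  - inner xL xR psi (derive1 u)
  - \sum_(i < N) trace_plus xL xR psi i * jump xL xR u i.

Definition Lminus (R : realType) (xL xR : R) (N : nat) (psi u : R -> R) : R :=
  - inner xL xR psi (derive1 u)
  - \sum_(i < N) trace_minus xL xR psi i * jump xL xR u i.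

Definition maxwellian (R : realType) (v : R) : R :=
  (Num.sqrt (2 * pi))^-1 * expR (- v ^+ 2 / 2).

Definition collision (R : realType) (sigma : R -> R -> R) (f : R -> R)
    (v : R) : R :=
  \int[lebesgue_measure]_w
    (sigma v w * (maxwellian v * f w - maxwellian w * f v)).

Definition coll_freq (R : realType) (sigma : R -> R -> R) (v : R) : R :=
  \int[lebesgue_measure]_w (sigma v w * maxwellian w).

Definition penalized (R : realType) (sigma : R -> R -> R) (mu : R)
    (f : R -> R) (v : R) : R :=
  collision sigma f v + mu * f v.

Definition density (R : realType) (f : R -> R -> R) (x : R) : R :=
  \int[lebesgue_measure]_v f x v.

Definition tau (R : realType) (mu dt eps : R) : R :=
  1 - expR (- (mu * dt / eps ^+ 2)).

Definition alpha (R : realType) (lam dt eps : R) : R :=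
  eps ^+ 2 / (eps ^+ 2 + lam * dt).

Definition beta (R : realType) (lam dt eps : R) : R :=
  dt * (1 - eps ^+ 2) / (eps ^+ 2 + lam * dt).

(* One step (rn, jn) |-> (rs, js, r1), where rs = r^*, js = j^*, r1 = r^{n+1}.
   Equality in V_h^k is equality on the open cells. *)
Definition scheme (R : realType) (xL xR : R) (N k : nat)
    (sigma : R -> R -> R) (mu dt eps : R) (rn jn rs js r1 : R -> R -> R) : Prop :=
  let t := tau mu dt eps in
  [/\ [/\ Vhv xL xR N k rs, Vhv xL xR N k js & Vhv xL xR N k r1],
      forall x v, cells xL xR N x ->
        rs x v = (1 - t) * rn x v
                 + t * (1 - t) * (penalized sigma mu (rn x) v / mu)
                 + t ^+ 2 * (density rn x * maxwellian v),
      forall v eta, Vh xL xR N k eta ->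
        inner xL xR (js ^~ v) eta
        = alpha (coll_freq sigma v) dt eps * inner xL xR (jn ^~ v) eta
          - beta (coll_freq sigma v) dt eps * v * Lplus xL xR N (rs ^~ v) eta
    & forall v xi, Vh xL xR N k xi ->
        inner xL xR (fun x => (r1 x v - rs x v) / dt) xi
        + v * Lminus xL xR N (js ^~ v) xi = 0].

Definition limit_scheme (R : realType) (xL xR : R) (N k : nat)
    (sigma : R -> R -> R) (dt : R) (rn rs js r1 : R -> R -> R) : Prop :=
  [/\ [/\ Vhv xL xR N k rs, Vhv xL xR N k js & Vhv xL xR N k r1],
      forall x v, cells xL xR N x -> rs x v = density rn x * maxwellian v,
      forall v eta, Vh xL xR N k eta ->
        inner xL xR (js ^~ v) eta
        = - (v / coll_freq sigma v) * Lplus xL xR N (rs ^~ v) eta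
    & forall v xi, Vh xL xR N k xi ->
        inner xL xR (fun x => (r1 x v - rs x v) / dt) xi
        + v * Lminus xL xR N (js ^~ v) xi = 0].

(* The relation j^* = - (v M / lambda) g^* which defines g^*. *)
Definition is_gstar (R : realType) (xL xR : R) (N : nat)
    (sigma : R -> R -> R) (js : R -> R -> R) (g : R -> R) : Prop :=
  forall x v, cells xL xR N x ->
    js x v = - (v * maxwellian v / coll_freq sigma v) * g x.

(* LDG scheme with alternating fluxes and forward Euler for
   d_t rho = D d_xx rho, the auxiliary variable g approximating d_x rho. *)
Definition LDG_diffusion (R : realType) (xL xR : R) (N k : nat)
    (D dt : R) (rho g rho1 : R -> R) : Prop :=
  [/\ [/\ Vh xL xR N k rho, Vh xL xR N k g & Vh xL xR N k rho1],
      forall eta, Vh xL xR N k eta ->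
        inner xL xR g eta = Lplus xL xR N rho eta
    & forall xi, Vh xL xR N k xi ->
        inner xL xR (fun x => (rho1 x - rho x) / dt) xi
        = D * Lminus xL xR N g xi].

(* Velocity profile whose integral is the diffusion coefficient D. *)
Definition diff_profile (R : realType) (sigma : R -> R -> R) (v : R) : R :=
  v ^+ 2 * maxwellian v / coll_freq sigma v.

Definition diff_coef (R : realType) (sigma : R -> R -> R) : R :=
  \int[lebesgue_measure]_v diff_profile sigma v.

(* Convergence in V_h^k for every v as eps -> 0+; V_h^k being
   finite-dimensional, it is pointwise convergence on the open cells. *)
Definition cvg_Vh (R : realType) (xL xR : R) (N : nat)
    (F : R -> R -> R -> R) (f : R -> R -> R) : Prop :=
  forall x v, cells xL xR N x -> F eps x v @[eps --> 0^'+] --> f x v.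

(* Convergence of the data r^n together with the two v-integrals of r^n that
   occur in the scheme. It holds trivially when r^n does not depend on eps. *)
Definition cvg_data (R : realType) (xL xR : R) (N : nat)
    (sigma : R -> R -> R) (F : R -> R -> R -> R) (f : R -> R -> R) : Prop :=
  [/\ cvg_Vh xL xR N F f,
      forall x, cells xL xR N x ->
        density (F eps) x @[eps --> 0^'+] --> density f x
    & forall x v, cells xL xR N x ->
        collision sigma (F eps x) v @[eps --> 0^'+] --> collision sigma (f x) v].

(* Main.v *)
Require Import Defs.
From HB Require Import structures.
From mathcomp Require Import all_boot all_order all_algebra.
From mathcomp Require Import all_classical all_reals all_analysis.
From mathcomp Require Import measurable_realfun.
From mathcomp Require Import ring lra zify.
Import Order.TTheory GRing.Theory Num.Theory.
Import numFieldNormedType.Exports.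
Local Open Scope classical_set_scope.
Local Open Scope ring_scope.

(** The space V_h^k is finite-dimensional, and this carries both halves of the
    theorem. A member of it is recovered on the cells from its values at k+1
    nodes per cell by Lagrange interpolation ([interp]), so every linear
    functional of its polynomial pieces is a finite combination of point values.
    Pointwise convergence on the cells therefore implies convergence of all the
    terms of the scheme ([cvg_inner], [cvg_Lplus], [cvg_Lminus]) and keeps the
    limit in the space ([Vh_cvg]).

    Conversely the scheme defines j^* and r^{n+1} only weakly, through inner
    products with test functions. The inner product is positive definite on
    polynomials, so evaluation at a point of a cell is the inner product with
    some test function ([riesz]). Convergence of the inner products with all
    test functions thus yields pointwise convergence ([weak_cvg]), and a member
    of V_h^k is determined on the cells by its inner products ([inner_inj]).

    For the limit eps -> 0 ([scheme_cvg]): r^* converges because its formula is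
    explicit and tau tends to 1; the right-hand side of the equation for j^* then
    converges because alpha -> 0 and beta -> 1/lambda, which makes j^* converge,
    and the last equation does the same for r^{n+1}.

    For the diffusion limit ([limit_scheme_LDG]): r^* = rho^n M makes every weak
    equation for j^* a multiple, by -v M / lambda, of one equation that does not
    involve v, whence g^*. The last equation then forces
    r^{n+1} = rho^n M + dt (v^2 M / lambda) G on the cells, where the function G
    of x alone represents the functional L^-(g^*, .). Integration in v, with
    total mass 1 for M, gives rho^{n+1} = rho^n + dt D G, which is the forward
    Euler step. *)

(** * Integrals of polynomials over an interval *)

Lemma Rintegral_eq0_negligible d (T : measurableType d) (R : realType)
    (mu : measure T R) (D : set T) (f : T -> R) :
  measurable D -> mu.-integrable D (EFin \o f) ->
  (forall x, D x -> 0 <= f x) ->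
  \int[mu]_(x in D) f x = 0 ->
  mu.-negligible (D `&` [set x | f x != 0]).
Proof.
move=> mD intf f0 If0.
have mf := measurable_int _ intf.
have h : (\int[mu]_(x in D) `|(EFin \o f) x| = 0)%E.
  rewrite -[RHS]/((0 : R)%:E) -If0 /Rintegral fineK ?integrable_fin_num//.
  by apply: eq_integral => x /set_mem Dx /=; rewrite ger0_norm ?f0.
have := proj1 (ae_eq_integral_abs mu mD mf) h.
apply: negligibleS => x [Dx /= /eqP fx0].
by move=> /(_ Dx) [].
Qed.

Section polynomial_integral.
Context {R : realType}.
Implicit Types (a b c : R) (p q : {poly R}).

Definition pint a b p : R := \int[lebesgue_measure]_(x in `[a, b]) p.[x].

Lemma integrable_poly a b p :
  (@lebesgue_measure R).-integrable `[a, b] (EFin \o horner p).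
Proof.
apply: continuous_compact_integrable; first exact: segment_compact.
by apply: continuous_subspaceT => x; exact: continuous_horner.
Qed.

Lemma pint_linear a b : scalar (pint a b).
Proof.
move=> c p q; rewrite /pint -RintegralZl ?integrable_poly//.
rewrite -RintegralD ?integrable_poly//; last first.
  have := integrable_poly a b (c *: p); apply: eq_integrable => // x _.
  by rewrite /= hornerZ.
by apply: eq_Rintegral => x _; rewrite hornerD hornerZ.
Qed.

HB.instance Definition _ a b :=
  GRing.isLinear.Build R {poly R} R *%R (pint a b) (pint_linear a b).

Lemma finite_roots p : p != 0 -> finite_set [set x | root p x].
Proof.
move=> p0; apply: contrapT => /(infinite_set_fset (size p))[X sX leX].
have := max_poly_roots p0 _ (finmap.fset_uniq X).
rewrite ltnNge leX => /(_ _)/negP; apply; first exact/allP.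
by [].
Qed.

(** A vanishing integral makes the square null almost everywhere, while a nonzero
    polynomial has finitely many roots. *)
Lemma pint_sqr_eq0 a b p : a < b -> pint a b (p * p) = 0 -> p = 0.
Proof.
move=> ab p20; apply: contrapT => /eqP p0.
have null : (@lebesgue_measure R).-negligible (`[a, b] : set R).
  have hp : (@lebesgue_measure R).-negligible [set x | root p x].
    have mr : measurable [set x | root p x].
      exact: countable_measurable (finite_set_countable (finite_roots _ p0)).
    apply/negligibleP => //.
    exact: countable_lebesgue_measure0 (finite_set_countable (finite_roots _ p0)).
  have hs : (@lebesgue_measure R).-negligible
      (`[a, b] `&` [set x | (p * p).[x] != 0]).
    apply: Rintegral_eq0_negligible => //; first exact: integrable_poly.
    by move=> x _; rewrite hornerM -expr2 sqr_ge0.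
  apply: negligibleS (negligibleU hs hp) => x xab.
  have [r|r] := boolP (root p x); first by right.
  by left; split=> //=; rewrite hornerM mulf_neq0.
have : (@lebesgue_measure R) `[a, b]%classic = 0%E.
  by apply: measure_negligible null; exact: measurable_itv.
move/eqP; rewrite lebesgue_measure_itv/= lte_fin ab -EFinB eqe subr_eq0.
by rewrite gt_eqF.
Qed.

(** The Gram matrix of the monomials is invertible by [pint_sqr_eq0], so the
    functional that evaluates at x, like any other, is represented by a
    polynomial of the same degree bound. *)
Lemma pint_riesz a b (n : nat) x : a < b ->
  exists2 q : {poly R}, (size q <= n)%N &
    forall p, (size p <= n)%N -> pint a b (p * q) = p.[x].
Proof.
move=> ab.
(* the Gram matrix of the monomials *)
pose G : 'M[R]_n := \matrix_(l, m) pint a b ('X^l * 'X^m).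
have rVE (c : 'rV[R]_n) : rVpoly c = \sum_(l < n) c 0 l *: 'X^l.
  rewrite /rVpoly poly_def; apply: eq_bigr => l _.
  by rewrite valK.
have GE (c d : 'rV[R]_n) :
    pint a b (rVpoly c * rVpoly d) = (c *m G *m d^T) 0 0.
  rewrite !rVE mxE mulr_sumr linear_sum; apply: eq_bigr => m _.
  rewrite mulr_suml linear_sum !mxE mulr_suml; apply: eq_bigr => l _.
  rewrite !mxE -scalerAl -scalerAr linearZ linearZ /=.
  by rewrite -mulrA (mulrC (d 0 m)).
have Gunit : G \in unitmx.
  rewrite -row_free_unit; apply: inj_row_free => c cG0.
  have := GE c c; rewrite cG0 mul0mx mxE => /(pint_sqr_eq0 _ _ _ ab) c0.
  by rewrite -[c]rVpolyK c0 linear0.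
(* the coordinates of the functional that evaluates at x *)
pose e : 'rV[R]_n := \row_m x ^+ m.
exists (rVpoly (invmx G *m e^T)^T); first exact: size_poly.
move=> p sp; rewrite -[p](poly_rV_K sp) GE trmxK mulmxA mulmxK//.
rewrite [in RHS]rVE horner_sum mxE; apply: eq_bigr => l _.
by rewrite !mxE hornerZ hornerXn.
Qed.

End polynomial_integral.

(** * Velocity space and the coefficients of the scheme *)

Section velocity.
Context {R : realType}.
Implicit Types (sigma : R -> R -> R) (v mu dt lam : R).

Lemma maxwellianE : @maxwellian R = normal_pdf 0 1.
Proof.
apply/funext => v; rewrite /maxwellian /normal_pdf oner_eq0 /normal_peak.
by rewrite /normal_fun subr0 expr1n mul1r mulr_natl.
Qed.

Lemma maxwellian_gt0 v : 0 < maxwellian v.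
Proof.
by rewrite mulr_gt0 ?expR_gt0// invr_gt0 sqrtr_gt0 mulr_gt0// pi_gt0.
Qed.

Lemma integrable_maxwellian :
  (@lebesgue_measure R).-integrable setT (EFin \o @maxwellian R).
Proof. by rewrite maxwellianE; exact: integrable_normal_pdf. Qed.

Lemma Rintegral_maxwellian : \int[lebesgue_measure]_v @maxwellian R v = 1.
Proof. by rewrite maxwellianE /Rintegral integral_normal_pdf. Qed.

(** The integrand is positive everywhere, so a zero integral would make the whole
    line a null set. *)
Lemma coll_freq_gt0 sigma v : (forall v w, 0 < sigma v w) ->
  (@lebesgue_measure R).-integrable [set: R]
    (fun w => (sigma v w * maxwellian w)%:E) ->
  0 < coll_freq sigma v.
Proof.
move=> s0 si.
have f0 w : 0 < sigma v w * maxwellian w by rewrite mulr_gt0 ?maxwellian_gt0.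
rewrite lt_neqAle Rintegral_ge0 ?andbT; last by move=> w _; exact: ltW.
apply/negP => /eqP/esym If0.
have null : (@lebesgue_measure R).-negligible
    (setT `&` [set w | sigma v w * maxwellian w != 0]).
  apply: Rintegral_eq0_negligible If0 => //.
  by move=> w _; exact: ltW.
(* any set of positive measure would do *)
have : (@lebesgue_measure R) `[0, 1]%classic = 0%E.
  apply: measure_negligible; first exact: measurable_itv.
  by apply: negligibleS null => w _; split=> //=; rewrite gt_eqF.
move/eqP; rewrite lebesgue_measure_itv/= lte_fin ltr01 -EFinB eqe subr0.
by rewrite oner_eq0.
Qed.

Let cvg_sqr : (eps ^+ 2 : R) @[eps --> (0 : R)^'+] --> (0 : R).
Proof.
have : (eps ^+ 2 : R) @[eps --> (0 : R)] --> (0 ^+ 2 : R) by exact: exprn_continuous.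
by rewrite expr0n; exact: cvg_at_right_filter.
Qed.

Lemma cvg_tau mu dt : 0 < mu -> 0 < dt ->
  tau mu dt eps @[eps --> 0^'+] --> (1 : R).
Proof.
move=> mu0 dt0; rewrite -[X in _ --> X]subr0; apply: cvgB; first exact: cvg_cst.
have m0 : 0 < mu * dt by exact: mulr_gt0.
have h : mu * dt / eps ^+ 2 @[eps --> (0 : R)^'+] --> +oo.
  have -> : (fun eps : R => mu * dt / eps ^+ 2)
      = unstable.inv_fun (fun eps => eps ^+ 2 / (mu * dt)).
    by apply/funext => e /=; rewrite invf_div.
  apply/cvgrVy.
    near=> e; rewrite divr_gt0// exprn_gt0//; near: e; exact: nbhs_right_gt.
  rewrite -[X in _ --> X](mul0r (mu * dt)^-1).
  by apply: cvgMr_tmp; exact: cvg_sqr.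
exact: (@cvg_comp _ _ _ (fun e => mu * dt / e ^+ 2) (fun x => expR (- x)) _ _ _
  h (@cvgr_expR R)).
Unshelve. all: by end_near. Qed.

Let cvg_den dt lam :
  (eps ^+ 2 + lam * dt : R) @[eps --> (0 : R)^'+] --> lam * dt.
Proof.
by rewrite -[X in _ --> X]add0r; apply: cvgD; [exact: cvg_sqr|exact: cvg_cst].
Qed.

Lemma cvg_alpha lam dt : 0 < lam -> 0 < dt ->
  alpha lam dt eps @[eps --> 0^'+] --> (0 : R).
Proof.
move=> lam0 dt0; rewrite -[X in _ --> X](mul0r (lam * dt)^-1).
apply: cvgM; first exact: cvg_sqr.
by apply: cvgV; [rewrite mulf_neq0 ?gt_eqF|exact: cvg_den].
Qed.

Lemma cvg_beta lam dt : 0 < lam -> 0 < dt ->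
  beta lam dt eps @[eps --> 0^'+] --> 1 / lam.
Proof.
move=> lam0 dt0.
(* the quotient of the limits of the numerator and of the denominator *)
have -> : 1 / lam = dt * (1 - 0) / (lam * dt) by field; rewrite !gt_eqF.
apply: cvgM; last by apply: cvgV; [rewrite mulf_neq0 ?gt_eqF|exact: cvg_den].
by apply: cvgMl_tmp; apply: cvgB; [exact: cvg_cst|exact: cvg_sqr].
Qed.

End velocity.

(** * Piecewise polynomials on the mesh *)

Section mesh.
Context {R : realType} (xL xR : R) (N : nat).
Hypotheses (x_lt : xL < xR) (N_gt0 : (0 < N)%N).
Local Notation a := (edge xL xR N).
Local Notation cell := (cell xL xR N).
Local Notation cells := (cells xL xR N).
Implicit Types (u w : R -> R) (p q : nat -> {poly R}).

Lemma edge0 : a 0 = xL.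
Proof. by rewrite /edge mul0r addr0. Qed.

Lemma edgeN : a N = xR.
Proof.
by rewrite /edge mulrC divfK ?pnatr_eq0 -?lt0n// addrC subrK.
Qed.

Let step_gt0 : 0 < (xR - xL) / N%:R.
Proof. by rewrite divr_gt0 ?subr_gt0// ltr0n. Qed.

Lemma edge_ltE i j : (a i < a j) = (i < j)%N.
Proof. by rewrite /edge ltrD2l ltr_pM2r// ltr_nat. Qed.

Lemma edge_lt i : a i < a i.+1.
Proof. by rewrite edge_ltE. Qed.

Lemma cell_inj i j x : cell i x -> cell j x -> i = j.
Proof.
rewrite /Defs.cell /= !in_itv/= => /andP[ix xi] /andP[jx xj].
have := lt_trans ix xj; have := lt_trans jx xi.
by rewrite !edge_ltE; lia.
Qed.

Lemma cellsP x : cells x <-> exists2 i, (i < N)%N & cell i x.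
Proof.
split=> [[i ix]|[i iN ix]]; first by exists i.
by exists (Ordinal iN).
Qed.

(** Pieces are indexed by natural numbers, and only those of index below N matter;
    this avoids ordinals when the neighbour of a cell is taken. *)
Definition pieces u p :=
  forall i, (i < N)%N -> forall x, cell i x -> u x = (p i).[x].

Definition glue p x : R :=
  \sum_(i < N) (if x \in (`]a i, a i.+1[%R : interval R) then (p i).[x] else 0).

Lemma pieces_glue p : pieces (glue p) p.
Proof.
move=> i iN x ix; rewrite /glue (bigD1 (Ordinal iN))//=.
rewrite [x \in _](ix : x \in _) big1 ?addr0// => j; rewrite -val_eqE/= => ji.
by case: ifPn => // jx; have /eqP := cell_inj _ _ _ jx ix; rewrite (negbTE ji).
Qed.

Lemma pieces_lin c d u w v p q :
  (forall x, cells x -> v x = c * u x + d * w x) ->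
  pieces u p -> pieces w q -> pieces v (fun i => c *: p i + d *: q i).
Proof.
move=> E up wq i iN x ix.
rewrite E; last by apply/cellsP; exists i.
by rewrite (up _ iN)// (wq _ iN)// hornerD !hornerZ.
Qed.

Lemma piecesM u w p q : pieces u p -> pieces w q ->
  pieces (fun x => u x * w x) (fun i => p i * q i).
Proof.
by move=> up wq i iN x ix; rewrite (up _ iN)// (wq _ iN)// hornerM.
Qed.

Lemma pieces_derive1 u p : pieces u p -> pieces (derive1 u) (fun i => (p i)^`()).
Proof.
move=> up i iN x ix; rewrite derive1E.
have -> : 'D_1 u x = 'D_1 (horner (p i)) x.
  apply: near_eq_derive; near=> y; apply: (up _ iN).
  by near: y; exact: near_in_itvoo.
exact: derive_val.
Unshelve. all: by end_near. Qed.

(** The values at the interfaces are arbitrary, but they sit on a null set: the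
    integral over each closed cell is that of the polynomial, and measurability
    across the interfaces is kept along the induction on the number of cells. *)
Lemma integral_pieces u p : pieces u p ->
  \int[lebesgue_measure]_(x in `[xL, xR]) u x =
  \sum_(i < N) pint (a i) (a i.+1) (p i).
Proof.
move=> up.
have mpoly (b c : R) b0 b1 (q : {poly R}) :
    measurable_fun [set` Interval (BSide b0 b) (BSide b1 c)] (horner q).
  apply: measurable_funTS; apply: continuous_measurable_fun.
  exact: continuous_horner.
have ucell i b0 b1 : (i < N)%N ->
    measurable_fun [set` Interval (BSide b0 (a i)) (BSide b1 (a i.+1))] u /\
    (\int[lebesgue_measure]_(x in
       [set` Interval (BSide b0 (a i)) (BSide b1 (a i.+1))]) (u x)%:E
     = (pint (a i) (a i.+1) (p i))%:E)%E.
  move=> iN.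
  have mo : measurable_fun `]a i, a i.+1[ u.
    apply: eq_measurable_fun (mpoly _ _ _ _ (p i)) => x /set_mem ix.
    by rewrite (up _ iN).
  split.
    apply: measurable_funS (measurable_fun_itv_cc mo) => //.
    move=> x /=; rewrite !in_itv/= => /andP[]; case: b0 b1 => [] [] /=; lra.
  rewrite (eq_integral_itv_bounded _ _ mo (mpoly _ _ _ _ (p i))).
    rewrite integral_itv_bndoo; last exact/measurable_EFinP.
    rewrite -(integral_itv_bndoo true false); last exact/measurable_EFinP.
    by rewrite /pint /Rintegral fineK// integrable_fin_num//; exact: integrable_poly.
  by move=> x ix; exact: up.
(* the closed cells overlap, so each step adds a half-open one *)
suff /(_ N (leqnn N))[_] : forall n, (n <= N)%N ->
    measurable_fun `[a 0, a n] u /\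
    (\int[lebesgue_measure]_(x in `[a 0%N, a n]) (u x)%:E =
     (\sum_(i < n) pint (a i) (a i.+1) (p i))%:E)%E.
  by rewrite edge0 edgeN /Rintegral => ->.
elim=> [_|n ih nN].
  by rewrite set_itv1 big_ord0 integral_set1; split=> //; exact: measurable_fun_set1.
have [mn In] := ih (ltnW nN).
have [mc Ic] := ucell n false false nN.
have E : `[a 0, a n.+1]%classic = `[a 0, a n] `|` `]a n, a n.+1].
  apply: itv_bndbnd_setU; rewrite bnd_simp; last exact/ltW/edge_lt.
  by rewrite leNgt edge_ltE.
have mU : measurable_fun `[a 0, a n.+1]%classic u.
  by rewrite E; apply/measurable_funU.
split=> //; rewrite E integral_setU//=.
- by rewrite big_ord_recr/= EFinD In Ic.
- by apply/measurable_EFinP; rewrite -E.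
- apply/disj_setPS => x [] /=; rewrite !in_itv/= => /andP[_ xn] /andP[nx _].
  by have := lt_le_trans nx xn; rewrite ltxx.
Qed.

Lemma inner_pieces u w p q : pieces u p -> pieces w q ->
  inner xL xR u w = \sum_(i < N) pint (a i) (a i.+1) (p i * q i).
Proof. by move=> up wq; exact: (integral_pieces _ _ (piecesM _ _ _ _ up wq)). Qed.

Lemma trace_plus_pieces u p (i : 'I_N) : pieces u p ->
  trace_plus xL xR u i = (p i).[a i].
Proof.
move=> up; apply: (cvg_lim (@Rhausdorff R)).
have : (p i).[x] @[x --> (a i)^'+] --> (p i).[a i].
  exact/cvg_at_right_filter/continuous_horner.
apply: cvg_trans; apply: near_eq_cvg; near=> x.
rewrite (up i)// /Defs.cell /= in_itv/=; apply/andP; split; near: x.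
  exact: nbhs_right_gt.
exact/nbhs_right_lt/edge_lt.
Unshelve. all: by end_near. Qed.

(** The cell to the left of the i-th interface; by periodicity the left neighbour
    of interface 0 is the last cell. *)
Definition left_cell (i : nat) : nat := (if i == 0 then N else i).-1.

Lemma left_cellS (i : 'I_N) : (left_cell i).+1 = if i == 0 :> nat then N else i.
Proof. by rewrite /left_cell prednK//; case: ifPn => //; rewrite lt0n. Qed.

Lemma left_cell_lt (i : 'I_N) : (left_cell i < N)%N.
Proof. by rewrite left_cellS; case: ifP => // _; exact: ltnW. Qed.

Lemma trace_minus_pieces u p (i : 'I_N) : pieces u p ->
  trace_minus xL xR u i = (p (left_cell i)).[a (left_cell i).+1].
Proof.
move=> up; rewrite /trace_minus -left_cellS; apply: (cvg_lim (@Rhausdorff R)).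
have : (p (left_cell i)).[x] @[x --> (a (left_cell i).+1)^'-]
         --> (p (left_cell i)).[a (left_cell i).+1].
  exact/cvg_at_left_filter/continuous_horner.
apply: cvg_trans; apply: near_eq_cvg; near=> x.
rewrite (up _ (left_cell_lt i))// /Defs.cell /= in_itv/=.
apply/andP; split; near: x.
  exact/nbhs_left_gt/edge_lt.
exact: nbhs_left_lt.
Unshelve. all: by end_near. Qed.

Lemma Lplus_pieces u w p q : pieces u p -> pieces w q ->
  Lplus xL xR N u w =
    - (\sum_(i < N) pint (a i) (a i.+1) (p i * (q i)^`()))
    - \sum_(i < N) (p i).[a i] * jump xL xR w i.
Proof.
move=> up wq; rewrite /Lplus (inner_pieces _ _ _ _ up (pieces_derive1 _ _ wq)).
by congr (_ - _); apply: eq_bigr => i _; rewrite (trace_plus_pieces _ _ _ up).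
Qed.

Lemma Lminus_pieces u w p q : pieces u p -> pieces w q ->
  Lminus xL xR N u w =
    - (\sum_(i < N) pint (a i) (a i.+1) (p i * (q i)^`()))
    - \sum_(i < N) (p (left_cell i)).[a (left_cell i).+1] * jump xL xR w i.
Proof.
move=> up wq; rewrite /Lminus (inner_pieces _ _ _ _ up (pieces_derive1 _ _ wq)).
by congr (_ - _); apply: eq_bigr => i _; rewrite (trace_minus_pieces _ _ _ up).
Qed.

(** * Interpolation at nodes *)

(** The denominators start at 2, which keeps the nodes off both endpoints of the
    open cell. *)
Definition node (i m : nat) : R := a i + (a i.+1 - a i) / m.+2%:R.

Lemma node_cell i m : cell i (node i m).
Proof.
have h := edge_lt i; have h0 : 0 < a i.+1 - a i by rewrite subr_gt0.
rewrite /Defs.cell /= in_itv/= /node; apply/andP; split.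
  by rewrite ltrDl divr_gt0// ltr0n.
by rewrite -ltrBrDl ltr_pdivrMr ?ltr0n// ltr_pMr// ltr1n.
Qed.

Lemma node_inj i : injective (node i).
Proof.
have h0 : a i.+1 - a i != 0 by rewrite subr_eq0 gt_eqF// edge_lt.
by move=> m n /addrI /(mulfI h0) /invr_inj /eqP; rewrite eqr_nat => /eqP[].
Qed.

Variable k : nat.
Local Notation Vh := (Vh xL xR N k).

Definition basis (i : nat) (m : 'I_k.+1) : {poly R} :=
  tnth (qpoly.lagrange k.+1 (node i)) m.

(** A canonical choice of pieces that depends linearly on finitely many values of
    u, so that limits can be taken in it. *)
Definition interp u (i : nat) : {poly R} :=
  \sum_(m < k.+1) u (node i m) *: basis i m.

Lemma size_interp u i : (size (interp u i) <= k.+1)%N.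
Proof.
apply: (leq_trans (size_sum _ _ _)); apply/bigmax_leqP => m _.
apply: (leq_trans (size_scale_leq _ _)).
by rewrite /basis qpoly.size_lagrange_//; exact: node_inj.
Qed.

Lemma pieces_interp u : Vh u -> pieces u (interp u).
Proof.
move=> uV i iN x ix; have [p sp up] := uV (Ordinal iN).
rewrite up//; congr (_.[x]).
rewrite [LHS](qpoly.lagrange_gen _ (node_inj i) sp)//.
apply: eq_bigr => m _; rewrite mul_polyC up//; exact: node_cell.
Qed.

Lemma pieces_Vh u p :
  (forall i, (i < N)%N -> (size (p i) <= k.+1)%N) -> pieces u p -> Vh u.
Proof.
by move=> sp up i; exists (p i); [exact: sp|move=> x; exact: up].
Qed.

(** * Linearity of the space and of the forms *)

Lemma Vh_lin c d u w v :
  (forall x, cells x -> v x = c * u x + d * w x) -> Vh u -> Vh w -> Vh v.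
Proof.
move=> E /pieces_interp up /pieces_interp wq.
apply: pieces_Vh (pieces_lin c d _ _ _ _ _ E up wq) => i _.
rewrite (leq_trans (size_polyD _ _))// geq_max.
by rewrite !(leq_trans (size_scale_leq _ _))// size_interp.
Qed.

Lemma inner_lin c d u w v eta :
  (forall x, cells x -> v x = c * u x + d * w x) ->
  Vh u -> Vh w -> Vh eta ->
  inner xL xR v eta = c * inner xL xR u eta + d * inner xL xR w eta.
Proof.
move=> E /pieces_interp up /pieces_interp wq /pieces_interp ep.
rewrite (inner_pieces _ _ _ _ (pieces_lin c d _ _ _ _ _ E up wq) ep).
rewrite (inner_pieces _ _ _ _ up ep) (inner_pieces _ _ _ _ wq ep) !mulr_sumr.
rewrite -big_split; apply: eq_bigr => i _ /=.
by rewrite mulrDl linearD -!scalerAl !linearZ.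
Qed.

Lemma Vh_eq u w : (forall x, cells x -> w x = u x) -> Vh u -> Vh w.
Proof.
move=> E uV; apply: (Vh_lin 1 0 u u) => // x xc.
by rewrite E// mul1r mul0r addr0.
Qed.

Lemma VhZ c u w : (forall x, cells x -> w x = c * u x) -> Vh u -> Vh w.
Proof.
move=> E uV; apply: (Vh_lin c 0 u u) => // x xc.
by rewrite E// mul0r addr0.
Qed.

Lemma innerZ c u w eta : (forall x, cells x -> w x = c * u x) ->
  Vh u -> Vh eta -> inner xL xR w eta = c * inner xL xR u eta.
Proof.
move=> E uV eV; rewrite (inner_lin c 0 u u) => // [|x xc].
  by rewrite mul0r addr0.
by rewrite E// mul0r addr0.
Qed.

Lemma inner_quot dt u w eta : Vh u -> Vh w -> Vh eta ->
  inner xL xR (fun x => (u x - w x) / dt) eta =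
  (inner xL xR u eta - inner xL xR w eta) / dt.
Proof.
move=> uV wV eV; rewrite (inner_lin dt^-1 (- dt^-1) u w) => // [|x _]; ring.
Qed.

Lemma LplusZ c u v eta : (forall x, cells x -> v x = c * u x) ->
  Vh u -> Vh eta -> Lplus xL xR N v eta = c * Lplus xL xR N u eta.
Proof.
move=> E /pieces_interp up /pieces_interp ep.
have vp : pieces v (fun i => c *: interp u i).
  move=> i iN x ix; rewrite E ?(up _ iN)// ?hornerZ//.
  by apply/cellsP; exists i.
rewrite (Lplus_pieces _ _ _ _ vp ep) (Lplus_pieces _ _ _ _ up ep).
rewrite mulrBr mulrN !mulr_sumr; congr (- _ - _); apply: eq_bigr => i _.
  by rewrite -scalerAl linearZ.
by rewrite hornerZ mulrA.
Qed.

Lemma LminusZ c u v eta : (forall x, cells x -> v x = c * u x) ->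
  Vh u -> Vh eta -> Lminus xL xR N v eta = c * Lminus xL xR N u eta.
Proof.
move=> E /pieces_interp up /pieces_interp ep.
have vp : pieces v (fun i => c *: interp u i).
  move=> i iN x ix; rewrite E ?(up _ iN)// ?hornerZ//.
  by apply/cellsP; exists i.
rewrite (Lminus_pieces _ _ _ _ vp ep) (Lminus_pieces _ _ _ _ up ep).
rewrite mulrBr mulrN !mulr_sumr; congr (- _ - _); apply: eq_bigr => i _.
  by rewrite -scalerAl linearZ.
by rewrite hornerZ mulrA.
Qed.

(** * Weak formulation and point values *)

(** The test function is the representing polynomial of [pint_riesz] on the cell
    that contains x, and zero on the other cells. *)
Lemma riesz x : cells x ->
  exists2 eta, Vh eta & forall u, Vh u -> inner xL xR u eta = u x.
Proof.
move=> /cellsP[i iN ix].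
have [q sq qE] := pint_riesz (a i) (a i.+1) k.+1 x (edge_lt i).
pose p j := if j == i then q else 0.
exists (glue p).
  apply: pieces_Vh (pieces_glue p) => j _.
  by rewrite /p; case: eqP => // _; rewrite size_poly0.
move=> u /pieces_interp up; rewrite (inner_pieces _ _ _ _ up (pieces_glue p)).
rewrite (bigD1 (Ordinal iN))//= big1 ?addr0; last first.
  by move=> j; rewrite -val_eqE/= /p => /negbTE ->; rewrite mulr0 linear0.
by rewrite /p eqxx qE ?size_interp// (up _ iN).
Qed.

Lemma inner_inj u w : Vh u -> Vh w ->
  (forall eta, Vh eta -> inner xL xR u eta = inner xL xR w eta) ->
  forall x, cells x -> u x = w x.
Proof.
move=> uV wV uw x /riesz[eta etaV E].
by rewrite -(E _ uV) -(E _ wV) uw.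
Qed.

(** * Passage to the limit *)

Lemma cvg_near_eq {T : Type} {V : topologicalType} (F : set_system T)
    {FF : Filter F} (f g : T -> V) (l : V) :
  (\forall e \near F, f e = g e) -> g e @[e --> F] --> l -> f e @[e --> F] --> l.
Proof.
move=> fg; apply: cvg_trans; apply: near_eq_cvg.
by apply: filterS fg => e ->.
Qed.

Section convergence.
Context {T : Type} (F : set_system T) {FF : ProperFilter F}.
Context (U : T -> R -> R) (u0 : R -> R).
Hypothesis U_Vh : \forall e \near F, Vh (U e).
Hypothesis U_cvg : forall x, cells x -> U e x @[e --> F] --> u0 x.

(** Continuity of a linear functional on polynomials of bounded degree, in terms
    of point values: its value on the interpolant is a combination of values at
    the nodes. *)
Lemma cvg_interp (L : {poly R} -> R) i : scalar L -> (i < N)%N ->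
  L (interp (U e) i) @[e --> F] --> L (interp u0 i).
Proof.
move=> linL iN.
pose L' : {linear {poly R} -> R | *%R} :=
  HB.pack L (GRing.isLinear.Build R {poly R} R *%R L linL).
have LE u : L (interp u i) = \sum_(m < k.+1) u (node i m) * L (basis i m).
  rewrite -[L]/(L' : _ -> _) linear_sum; apply: eq_bigr => m _.
  by rewrite linearZ.
rewrite LE; under eq_fun do rewrite LE.
apply: cvg_big => [|m _]; first exact: add_continuous.
apply: cvgMr_tmp; apply: U_cvg; apply/cellsP; exists i => //; exact: node_cell.
Qed.

(** Eventually U e agrees with its interpolant on the cells, and interpolants
    converge pointwise to the interpolant of u0, so u0 agrees with its own. *)
Lemma Vh_cvg : Vh u0.
Proof.
apply: (@pieces_Vh _ (interp u0)) => [i _|i iN x ix]; first exact: size_interp.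
have xc : cells x by apply/cellsP; exists i.
have h : (interp (U e) i).[x] @[e --> F] --> (interp u0 i).[x].
  by apply: (cvg_interp (horner^~ x)) => // c p q; rewrite hornerD hornerZ.
apply: (cvg_unique (@Rhausdorff R) (U_cvg _ xc)); apply: cvg_near_eq h.
by move: U_Vh; apply: filterS => e /pieces_interp Up; rewrite (Up _ iN).
Qed.

Let cvg_pint (q : {poly R}) i : (i < N)%N ->
  pint (a i) (a i.+1) (interp (U e) i * q) @[e --> F]
    --> pint (a i) (a i.+1) (interp u0 i * q).
Proof.
move=> iN.
apply: (cvg_interp (fun p : {poly R} => pint (a i) (a i.+1) (p * q))) => //.
by move=> c p1 p2; rewrite mulrDl linearD -scalerAl linearZ.
Qed.

Let cvg_horner y i : (i < N)%N ->
  (interp (U e) i).[y] @[e --> F] --> (interp u0 i).[y].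
Proof.
by move=> iN; apply: (cvg_interp (horner^~ y)) => // c p q; rewrite hornerD hornerZ.
Qed.

Lemma cvg_inner eta : Vh eta ->
  inner xL xR (U e) eta @[e --> F] --> inner xL xR u0 eta.
Proof.
move=> /pieces_interp ep.
rewrite (inner_pieces _ _ _ _ (pieces_interp _ Vh_cvg) ep).
apply: cvg_near_eq.
  move: U_Vh; apply: filterS => e /pieces_interp Up.
  exact: (inner_pieces _ _ _ _ Up ep).
by apply: cvg_big => [|i _]; [exact: add_continuous|exact: cvg_pint].
Qed.

Lemma cvg_Lplus eta : Vh eta ->
  Lplus xL xR N (U e) eta @[e --> F] --> Lplus xL xR N u0 eta.
Proof.
move=> /pieces_interp ep.
rewrite (Lplus_pieces _ _ _ _ (pieces_interp _ Vh_cvg) ep).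
apply: cvg_near_eq.
  move: U_Vh; apply: filterS => e /pieces_interp Up.
  exact: (Lplus_pieces _ _ _ _ Up ep).
apply: cvgB.
  apply: cvgN; apply: cvg_big => [|i _]; first exact: add_continuous.
  by apply: cvg_pint; exact: ltn_ord.
apply: cvg_big => [|i _]; first exact: add_continuous.
by apply: cvgMr_tmp; apply: cvg_horner; exact: ltn_ord.
Qed.

Lemma cvg_Lminus eta : Vh eta ->
  Lminus xL xR N (U e) eta @[e --> F] --> Lminus xL xR N u0 eta.
Proof.
move=> /pieces_interp ep.
rewrite (Lminus_pieces _ _ _ _ (pieces_interp _ Vh_cvg) ep).
apply: cvg_near_eq.
  move: U_Vh; apply: filterS => e /pieces_interp Up.
  exact: (Lminus_pieces _ _ _ _ Up ep).
apply: cvgB.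
  apply: cvgN; apply: cvg_big => [|i _]; first exact: add_continuous.
  by apply: cvg_pint; exact: ltn_ord.
apply: cvg_big => [|i _]; first exact: add_continuous.
by apply: cvgMr_tmp; apply: cvg_horner; exact: left_cell_lt.
Qed.

End convergence.
Arguments Vh_cvg {T F FF U u0}.
Arguments cvg_inner {T F FF U u0} U_Vh U_cvg {eta}.
Arguments cvg_Lplus {T F FF U u0} U_Vh U_cvg {eta}.
Arguments cvg_Lminus {T F FF U u0} U_Vh U_cvg {eta}.

(** Point values are inner products by [riesz], so they converge too. This is what
    turns the weak equations for j^* and r^{n+1} into convergence. *)
Lemma weak_cvg {T : Type} (F : set_system T) {FF : ProperFilter F}
    (U : T -> R -> R) (L : (R -> R) -> R) :
  (\forall e \near F, Vh (U e)) ->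
  (forall eta, Vh eta -> inner xL xR (U e) eta @[e --> F] --> L eta) ->
  exists u0, [/\ Vh u0, forall x, cells x -> U e x @[e --> F] --> u0 x
    & forall eta, Vh eta -> inner xL xR u0 eta = L eta].
Proof.
move=> U_Vh U_cvg; pose u0 x := lim (U e x @[e --> F]).
have U_u0 x : cells x -> U e x @[e --> F] --> u0 x.
  move=> /riesz[eta etaV E].
  suff h : U e x @[e --> F] --> L eta by rewrite /u0 (cvg_lim (@Rhausdorff R) h).
  apply: cvg_near_eq (U_cvg _ etaV).
  by move: U_Vh; apply: filterS => e /E ->.
exists u0; split=> //; first exact: Vh_cvg U_Vh U_u0.
move=> eta etaV.
apply: (cvg_unique (@Rhausdorff R) (cvg_inner U_Vh U_u0 etaV)).
exact: U_cvg.
Qed.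

(** * The scheme and its limits *)

Section schemes.
Context (sigma : R -> R -> R) (mu dt : R).
Hypotheses (mu_gt0 : 0 < mu) (dt_gt0 : 0 < dt).
Hypothesis lam_gt0 : forall v, 0 < coll_freq sigma v.

(** The limits are obtained in the order in which one step of the scheme computes
    its unknowns; the limits of j^* and r^{n+1} are found for each velocity
    separately and then collected by choice. *)
Lemma scheme_cvg (Rn Jn Rs Js R1 : R -> R -> R -> R) (rn jn : R -> R -> R) :
  (forall eps, 0 < eps < 1 ->
     [/\ Vhv xL xR N k (Rn eps), Vhv xL xR N k (Jn eps)
       & scheme xL xR N k sigma mu dt eps
           (Rn eps) (Jn eps) (Rs eps) (Js eps) (R1 eps)]) ->
  cvg_data xL xR N sigma Rn rn -> cvg_Vh xL xR N Jn jn ->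
  exists rs js r1 : R -> R -> R,
    limit_scheme xL xR N k sigma dt rn rs js r1 /\
    [/\ cvg_Vh xL xR N Rs rs, cvg_Vh xL xR N Js js & cvg_Vh xL xR N R1 r1].
Proof.
move=> S [Rn_rn dens coll] Jn_jn.
have {}S : \forall eps \near (0 : R)^'+,
    [/\ Vhv xL xR N k (Rn eps), Vhv xL xR N k (Jn eps)
       & scheme xL xR N k sigma mu dt eps
           (Rn eps) (Jn eps) (Rs eps) (Js eps) (R1 eps)].
  near=> eps; apply: S; apply/andP; split; near: eps.
    exact: nbhs_right_gt.
  exact: nbhs_right_lt.
pose rs x v := density rn x * maxwellian v.
have Rs_rs : cvg_Vh xL xR N Rs rs.
  move=> x v xc; apply: cvg_near_eq.
    by move: S; apply: filterS => eps [_ _ [_ E _ _]]; exact: E.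
  (* the formula for r^* at tau = 1 *)
  have -> : rs x v = (1 - 1) * rn x v
      + 1 * (1 - 1) * (penalized sigma mu (rn x) v / mu)
      + 1 ^+ 2 * (density rn x * maxwellian v) by rewrite /rs; ring.
  have ct := cvg_tau _ _ mu_gt0 dt_gt0.
  have ct1 : 1 - tau mu dt eps @[eps --> (0 : R)^'+] --> (1 - 1 : R).
    by apply: cvgB => //; exact: cvg_cst.
  apply: cvgD; first apply: cvgD.
  - by apply: cvgM => //; exact: Rn_rn.
  - apply: cvgM; first exact: cvgM.
    apply: cvgMr_tmp; apply: cvgD; first exact: coll.
    by apply: cvgMl_tmp; exact: Rn_rn.
  - apply: cvgM; first exact: cvgM.
    by apply: cvgMr_tmp; exact: dens.
have RsV v : \forall eps \near (0 : R)^'+, Vh (Rs eps ^~ v).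
  by move: S; apply: filterS => eps [_ _ [[h _ _] _ _ _]]; exact: h.
have JnV v : \forall eps \near (0 : R)^'+, Vh (Jn eps ^~ v).
  by move: S; apply: filterS => eps [_ h _]; exact: h.
have JsV v : \forall eps \near (0 : R)^'+, Vh (Js eps ^~ v).
  by move: S; apply: filterS => eps [_ _ [[_ h _] _ _ _]]; exact: h.
have R1V v : \forall eps \near (0 : R)^'+, Vh (R1 eps ^~ v).
  by move: S; apply: filterS => eps [_ _ [[_ _ h] _ _ _]]; exact: h.
have rsV v : Vh (rs ^~ v) := Vh_cvg (RsV v) (fun x => Rs_rs x v).
have /choice[js jsP] : forall v, exists u0, [/\ Vh u0,
    forall x, cells x -> Js eps x v @[eps --> 0^'+] --> u0 x
    & forall eta, Vh eta -> inner xL xR u0 eta =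
        - (v / coll_freq sigma v) * Lplus xL xR N (rs ^~ v) eta].
  move=> v; apply: weak_cvg => // eta etaV; apply: cvg_near_eq.
    by move: S; apply: filterS => eps [_ _ [_ _ E _]]; exact: E.
  (* the right-hand side at alpha = 0 and beta = 1 / lambda *)
  have -> : - (v / coll_freq sigma v) * Lplus xL xR N (rs ^~ v) eta =
     0 * inner xL xR (jn ^~ v) eta
     - 1 / coll_freq sigma v * v * Lplus xL xR N (rs ^~ v) eta by ring.
  apply: cvgB; apply: cvgM.
  - exact: cvg_alpha.
  - exact: (cvg_inner (JnV v) (fun x => Jn_jn x v)).
  - by apply: cvgMr_tmp; exact: cvg_beta.
  - exact: (cvg_Lplus (RsV v) (fun x => Rs_rs x v)).
have /choice[r1 r1P] : forall v, exists u0, [/\ Vh u0,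
    forall x, cells x -> R1 eps x v @[eps --> 0^'+] --> u0 x
    & forall eta, Vh eta -> inner xL xR u0 eta =
        inner xL xR (rs ^~ v) eta - dt * v * Lminus xL xR N (js v) eta].
  move=> v; have [jsV Js_js _] := jsP v.
  apply: weak_cvg => // eta etaV.
  apply: (@cvg_near_eq _ _ _ _ _ (fun eps => inner xL xR (Rs eps ^~ v) eta
      - dt * v * Lminus xL xR N (Js eps ^~ v) eta)).
    move: S; apply: filterS => eps [_ _ [[rV _ r1V] _ _ /(_ v eta etaV)]].
    rewrite inner_quot// => /eqP; rewrite addr_eq0 => /eqP E.
    apply/eqP; rewrite -subr_eq0 opprB addrCA addrC; apply/eqP.
    have := congr1 (fun z => z * dt) E; rewrite divfK ?gt_eqF// => ->; ring.
  apply: cvgB; first exact: (cvg_inner (RsV v) (fun x => Rs_rs x v)).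
  by apply: cvgMl_tmp; exact: (cvg_Lminus (JsV v) Js_js).
exists rs, (fun x v => js v x), (fun x v => r1 v x); split; last first.
  split=> // x v xc; first by have [_ h _] := jsP v; exact: h.
  by have [_ h _] := r1P v; exact: h.
split=> //.
- split=> v; [exact: rsV|by have [] := jsP v|by have [] := r1P v].
- by move=> v eta etaV; have [_ _ ->] := jsP v.
- move=> v xi xiV; have [r1V _ E] := r1P v.
  rewrite inner_quot//; last exact: rsV.
  rewrite (E _ xiV); field; exact: lt0r_neq0.
Unshelve. all: by end_near. Qed.

(** The velocity 1 serves to define g^* and G, since the factors v M / lambda and
    v^2 M / lambda do not vanish there; that the same functions work for every
    velocity follows from [inner_inj], both sides having equal inner products
    with all test functions. *)
Lemma limit_scheme_LDG (rn rs js r1 : R -> R -> R) :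
  (@lebesgue_measure R).-integrable [set: R]
    (fun v => (diff_profile sigma v)%:E) ->
  limit_scheme xL xR N k sigma dt rn rs js r1 ->
  [/\ forall x, cells x ->
        (@lebesgue_measure R).-integrable [set: R] (fun v => (r1 x v)%:E),
      exists g, is_gstar xL xR N sigma js g
    & forall g, is_gstar xL xR N sigma js g ->
        LDG_diffusion xL xR N k (diff_coef sigma) dt
          (density rn) g (density r1)].
Proof.
move=> Dint [[rsV jsV r1V] rsE jsE r1E].
have M0 v : maxwellian v != 0 :> R by rewrite gt_eqF ?maxwellian_gt0.
have l0 v : coll_freq sigma v != 0 by rewrite gt_eqF.
have dt0 : dt != 0 by rewrite gt_eqF.
pose rho := density rn.
have rhoV : Vh rho.
  apply: (VhZ (maxwellian 0)^-1 _ _ _ (rsV 0)) => x xc.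
  by rewrite rsE// mulrC mulfK.
have Lrs v eta : Vh eta ->
    Lplus xL xR N (rs ^~ v) eta = maxwellian v * Lplus xL xR N rho eta.
  by move=> etaV; apply: LplusZ => // x xc; rewrite rsE// mulrC.
pose c v : R := - (v * maxwellian v / coll_freq sigma v).
have c1 : c 1 != 0 by rewrite oppr_eq0 mulf_neq0 ?invr_eq0 ?mul1r.
pose g0 x := (c 1)^-1 * js x 1.
have g0V : Vh g0 by apply: (VhZ (c 1)^-1 _ _ _ (jsV 1)).
have inner_js v eta : Vh eta ->
    inner xL xR (js ^~ v) eta = c v * Lplus xL xR N rho eta.
  by move=> etaV; rewrite jsE// Lrs// /c; ring.
have g0E : is_gstar xL xR N sigma js g0.
  move=> x v; apply: (inner_inj (js ^~ v) (fun x => c v * g0 x)) => //.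
    exact: (VhZ (c v) g0).
  move=> eta etaV; rewrite inner_js// (innerZ (c v) g0)//.
  by rewrite (innerZ (c 1)^-1 (js ^~ 1))// inner_js// mulKf.
have gP g : is_gstar xL xR N sigma js g -> forall x, cells x -> g x = g0 x.
  by move=> gE x xc; rewrite /g0 gE// mulKf.
pose P v := diff_profile sigma v.
have Pc v : P v = - (v * c v) by rewrite /P /diff_profile /c; ring.
have P1 : P 1 != 0 by rewrite Pc mul1r oppr_eq0.
(* the increment (r1 - rs) / (dt * P v), the same for every v with P v <> 0 *)
pose G x := (dt * P 1)^-1 * (r1 x 1 - rs x 1).
have inner_r1 v eta : Vh eta -> inner xL xR (r1 ^~ v) eta =
    inner xL xR (rs ^~ v) eta + dt * P v * Lminus xL xR N g0 eta.
  move=> etaV; have := r1E v eta etaV; rewrite inner_quot//.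
  rewrite (LminusZ (c v) g0)//; last by move=> x xc; rewrite g0E.
  move=> E; rewrite Pc; apply/eqP; rewrite -subr_eq0; apply/eqP.
  rewrite -[RHS](mulr0 dt) -E; field.
  exact: dt0.
have GV : Vh G.
  apply: (Vh_lin (dt * P 1)^-1 (- (dt * P 1)^-1) (r1 ^~ 1) (rs ^~ 1)) => //.
  by move=> x _; rewrite /G; ring.
have inner_G eta : Vh eta -> inner xL xR G eta = Lminus xL xR N g0 eta.
  move=> etaV.
  rewrite (inner_lin (dt * P 1)^-1 (- (dt * P 1)^-1) (r1 ^~ 1) (rs ^~ 1))//.
    rewrite inner_r1//; field; rewrite P1; exact: dt0.
  by move=> x _; rewrite /G; ring.
have r1G x v : cells x ->
    r1 x v = rho x * maxwellian v + dt * G x * P v.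
  move=> xc; rewrite -rsE//; move: x xc.
  apply: (inner_inj (r1 ^~ v) (fun x => rs x v + dt * G x * P v)) => //.
    apply: (Vh_lin 1 (dt * P v) (rs ^~ v) G) => // x _; ring.
  move=> eta etaV; rewrite inner_r1//.
  rewrite (inner_lin 1 (dt * P v) (rs ^~ v) G (fun x => rs x v + dt * G x * P v))//.
    by rewrite inner_G// mul1r.
  by move=> x _; ring.
have int1 x : (@lebesgue_measure R).-integrable setT
    (fun v => (rho x * maxwellian v)%:E).
  exact: (integrableZl _ (rho x) integrable_maxwellian).
have int2 x : (@lebesgue_measure R).-integrable setT
    (fun v => (dt * G x * P v)%:E).
  exact: (integrableZl _ (dt * G x) Dint).
have r1fun x : cells x ->
    r1 x = (fun v => rho x * maxwellian v + dt * G x * P v).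
  by move=> xc; apply/funext => v; exact: r1G.
have rho1E x : cells x ->
    density r1 x = 1 * rho x + dt * diff_coef sigma * G x.
  move=> xc; rewrite /density r1fun// (RintegralD measurableT (int1 x) (int2 x)).
  rewrite (RintegralZl _ measurableT integrable_maxwellian).
  by rewrite (RintegralZl _ measurableT Dint) Rintegral_maxwellian /diff_coef; ring.
split.
- by move=> x xc; rewrite r1fun//; exact: (integrableD _ (int1 x) (int2 x)).
- by exists g0.
move=> g /gP gg0.
have gV : Vh g by apply: Vh_eq g0V.
have rho1V : Vh (density r1) by exact: Vh_lin rho1E rhoV GV.
split=> // [eta etaV|xi xiV].
  rewrite (innerZ 1 g0)// => [|x xc]; last by rewrite gg0// mul1r.
  by rewrite mul1r (innerZ (c 1)^-1 (js ^~ 1))// inner_js// mulKf.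
rewrite inner_quot// (inner_lin _ _ _ _ _ _ rho1E)// inner_G//.
rewrite (LminusZ 1 g0 g)//; last by move=> x xc; rewrite gg0// mul1r.
field; exact: dt0.
Qed.

End schemes.
End mesh.

Theorem mainTheorem2 (R : realType) (xL xR : R) (N k : nat)
    (sigma : R -> R -> R) (mu dt : R)
    (x_lt : xL < xR) (N_gt0 : (0 < N)%N)
    (sigma_sym : forall v w, sigma v w = sigma w v)
    (sigma_gt0 : forall v w, 0 < sigma v w)
    (sigma_int : forall v, (@lebesgue_measure R).-integrable [set: R]
       (fun w => (sigma v w * maxwellian w)%:E))
    (mu_gt0 : 0 < mu) (lambda_le : forall v, coll_freq sigma v <= mu)
    (dt_gt0 : 0 < dt) :
  [/\ (* limits of the coefficients *)
      [/\ tau mu dt eps @[eps --> 0^'+] --> (1 : R),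
          forall v, alpha (coll_freq sigma v) dt eps @[eps --> 0^'+] --> (0 : R)
        & forall v, beta (coll_freq sigma v) dt eps @[eps --> 0^'+]
                      --> 1 / coll_freq sigma v],
      (* the scheme becomes the limiting scheme: its solutions converge to a
         solution of the limiting scheme *)
      forall (Rn Jn Rs Js R1 : R -> R -> R -> R) (rn jn : R -> R -> R),
        (forall eps, 0 < eps < 1 ->
           [/\ Vhv xL xR N k (Rn eps), Vhv xL xR N k (Jn eps)
             & scheme xL xR N k sigma mu dt eps
                 (Rn eps) (Jn eps) (Rs eps) (Js eps) (R1 eps)]) ->
        Vhv xL xR N k rn -> Vhv xL xR N k jn ->
        cvg_data xL xR N sigma Rn rn -> cvg_Vh xL xR N Jn jn ->
        exists rs js r1 : R -> R -> R,
          limit_scheme xL xR N k sigma dt rn rs js r1 /\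
          [/\ cvg_Vh xL xR N Rs rs, cvg_Vh xL xR N Js js & cvg_Vh xL xR N R1 r1]
    & (* the limiting scheme is the LDG scheme for the diffusion equation *)
      (@lebesgue_measure R).-integrable [set: R]
        (fun v => (diff_profile sigma v)%:E) ->
      forall rn rs js r1 : R -> R -> R,
        Vhv xL xR N k rn -> limit_scheme xL xR N k sigma dt rn rs js r1 ->
        [/\ forall x, cells xL xR N x ->
              (@lebesgue_measure R).-integrable [set: R]
                (fun v => (r1 x v)%:E),
            exists g, is_gstar xL xR N sigma js g
          & forall g, is_gstar xL xR N sigma js g ->
              LDG_diffusion xL xR N k (diff_coef sigma) dt
                (density rn) g (density r1)]].
Proof.
have lam_gt0 v : 0 < coll_freq sigma v by exact: coll_freq_gt0.
split.
- by split=> [|v|v]; [exact: cvg_tau|exact: cvg_alpha|exact: cvg_beta].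
- move=> Rn Jn Rs Js R1 rn jn S _ _ Rn_rn Jn_jn.
  exact: (scheme_cvg xL xR N x_lt N_gt0 k sigma mu dt mu_gt0 dt_gt0 lam_gt0
            Rn Jn Rs Js R1 rn jn S Rn_rn Jn_jn).
- move=> Dint rn rs js r1 _ S.
  exact: (limit_scheme_LDG xL xR N x_lt N_gt0 k sigma dt dt_gt0 lam_gt0
            rn rs js r1 Dint S).
Qed.
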